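(* Let $\{X_n:n\in\mathbb{N}\}$ be a family of Tychonoff spaces and let $X=\prod_{n\in\mathbb{N}}X_n$ with the product topology. If for each $n\in\mathbb{N}$ the product $\prod_{k=1}^n X_k$ is S-separable, then $X$ is S-separable.
   Context: A space $X$ is S-separable if for every sequence $(Y_n)_{n\in\mathbb{N}}$ of dense subspaces of $X$ there exists a sequence $(F_n)_{n\in\mathbb{N}}$ such that each $F_n$ is a finite subset of $Y_n$ and for each finite collection $\mathcal{F}$ of nonempty open sets of $X$ there exists $n\in\mathbb{N}$ with $U\cap F_n\neq\emptyset$ for all $U\in\mathcal{F}$. Here $\mathbb{N}=\{1,2,3,\dots\}$. *)

(* Defs.v *)
From HB Require Import structures.
From mathcomp Require Import all_boot all_order all_algebra.
From mathcomp Require Import all_classical all_reals all_analysis.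

Set Implicit Arguments.
Unset Strict Implicit.
Unset Printing Implicit Defensive.

Local Open Scope classical_set_scope.

(* T1 and completely regular. By [uniform_separatorP], the library's
   [completely_regular_space] says that a point and a closed set not containing
   it are separated by a continuous function into [0, 1]. *)
Definition tychonoff_space (T : topologicalType) : Prop :=
  accessible_space T /\ completely_regular_space T.

Definition S_separable (T : topologicalType) : Prop :=
  forall Y : nat -> set T, (forall n, dense (Y n)) ->
  exists F : nat -> set T,
    (forall n, finite_set (F n) /\ F n `<=` Y n) /\
    forall C : set (set T), finite_set C ->
      (forall U, C U -> open U /\ U !=set0) ->
      exists n, forall U, C U -> U `&` F n !=set0.

(* Main.v *)
Require Import Defs.
From HB Require Import structures.
From mathcomp Require Import all_boot all_order all_algebra.
From mathcomp Require Import all_classical all_reals all_analysis.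

(** Each nonempty open set of the product contains a cylinder over a nonempty
    open set of [X 0 * ... * X n] for all large [n], so finitely many open sets
    share such an [n]. Split the given sequence of dense sets into countably
    many subsequences, project the [n]-th one to the first [n+1] factors, apply
    S-separability there, and lift the finite sets so obtained. *)

Local Open Scope classical_set_scope.

Definition initial_factors (X : nat -> topologicalType) (n : nat)
    (x : prod_topology X) : prod_topology (fun k : 'I_n.+1 => X k) :=
  fun k => x k.
Arguments initial_factors {X} n x.

(** The product topology is the supremum of the topologies induced by the projections, so
    convergence can be tested one coordinate at a time. *)
Lemma cvg_prod_topology (I : eqType) (K : I -> topologicalType)
    (F : set_system (prod_topology K)) (x : prod_topology K) :
  Filter F -> (forall i V, nbhs (x i) V -> F (proj i @^-1` V)) -> F --> x.
Proof.
move=> FF Fproj; apply/cvg_sup => i W [_ [[V oV <-] Vx] VW].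
by apply: (@filterS _ F FF _ _ VW); apply: Fproj; exact: open_nbhs_nbhs.
Qed.

Lemma initial_factors_continuous (X : nat -> topologicalType) (n : nat) :
  continuous (@initial_factors X n).
Proof.
move=> y; apply: cvg_prod_topology; first exact/fmap_filter/nbhs_filter.
by move=> k V; exact: (@proj_continuous _ X (k : nat) y).
Qed.

Lemma nbhs_cylinder (X : nat -> topologicalType) (x : prod_topology X)
    (U : set (prod_topology X)) : nbhs x U ->
  \forall n \near \oo, exists2 V,
    nbhs (initial_factors n x) V & initial_factors n @^-1` V `<=` U.
Proof.
(* The sets [W] with the required property form a filter. Hence [F --> x] need only be checked on
   preimages under [proj i], where every [n >= i] works. *)
pose F : set_system (prod_topology X) := [set W | \forall n \near \oo,
  exists2 V, nbhs (initial_factors n x) V & initial_factors n @^-1` V `<=` W].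
have FF : Filter F.
  split.
  - by apply: nearW => n; exists setT => //; exact: filterT.
  - move=> A B; rewrite /F /=; apply: filterS2 => n [V nV VA] [W nW WB].
    exists (V `&` W); first exact: filterI.
    by move=> y [/VA ? /WB ?].
  - move=> A B AB; rewrite /F /=; apply: filterS => n [V nV VA].
    by exists V => //; exact: subset_trans AB.
suff : F --> x by exact.
apply: cvg_prod_topology => i V Vx; exists i => // n /= le_in.
have lt_in : (i < n.+1)%N by [].
exists (proj (Ordinal lt_in) @^-1` V) => //.
exact: (@proj_continuous _ (fun k : 'I_n.+1 => X k)).
Qed.

Lemma near_finite_set (T : Type) (I : choiceType) (F : set_system T)
    (C : set I) (P : I -> set T) :
  Filter F -> finite_set C -> (forall i, C i -> F (P i)) ->
  F [set t | forall i, C i -> P i t].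
Proof. by move=> FF /finite_fsetP[D ->]; exact: filter_bigI. Qed.

Lemma dense_initial_factors (X : nat -> topologicalType) (n : nat)
    (x : prod_topology X) (Y : set (prod_topology X)) :
  dense Y -> dense (initial_factors n @` Y).
Proof.
move=> dY V [v Vv] oV.
have [|y [Vy Yy]] := dY (initial_factors n @^-1` V) _
    ((continuousP _).1 (initial_factors_continuous X n) _ oV).
  (* The base point [x] supplies the coordinates beyond [n], so that [v] extends to a point of the
     whole product. *)
  pose z : prod_topology X := fun k =>
    if ltnP k n.+1 is LtnNotGeq lt_kn then v (Ordinal lt_kn) else x k.
  exists z; rewrite /preimage/=; suff -> : initial_factors n z = v by [].
  apply: functional_extensionality_dep => -[k lt_kn].
  rewrite /initial_factors /z /=; case: ltnP => [lt_kn'|le_nk]; last first.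
    by have := leq_trans lt_kn le_nk; rewrite ltnn.
  by congr (v (Ordinal _)); exact: bool_irrelevance.
by exists (initial_factors n y); split => //; exists y.
Qed.

Lemma finite_lift (S T : Type) (f : S -> T) (Y : set S) (F : set T) :
  finite_set F -> F `<=` f @` Y ->
  exists G, [/\ finite_set G, G `<=` Y & f @` G = F].
Proof.
(* [S] may be empty when [F] is; otherwise a preimage [s0] of [t0] serves as default value for the
   choice function outside [F]. *)
have [->|/set0P[t0 Ft0]] := eqVneq F set0.
  by exists set0; split => //; exact: image_set0.
move=> finF FY; have [s0 _ _] := FY t0 Ft0.
have /choice[g gP] t : exists s, F t -> Y s /\ f s = t.
  have [/FY[s Ys fs]|nFt] := pselect (F t); first by exists s.
  by exists s0.
exists (g @` F); split; first exact: finite_image.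
  by move=> _ [t Ft <-]; exact: (gP t Ft).1.
rewrite eqEsubset; split=> [_ [_ [t Ft <-] <-]|t Ft].
  by rewrite (gP t Ft).2.
by exists (g t); [exists t|exact: (gP t Ft).2].
Qed.

(* Indices are shifted by one: [X k] is the (k+1)-st factor, so the hypothesis
   at [n] is about the product of the first n+1 factors. *)
Theorem theorem3p11 (X : nat -> topologicalType)
    (tychX : forall n : nat, tychonoff_space (X n))
    (sepX : forall n : nat,
      S_separable (prod_topology (fun k : 'I_n.+1 => X k))) :
  S_separable (prod_topology X).
Proof.
move=> Y dY.
(* Extending points of finite products needs a base point [x]; in an empty product no open set is
   nonempty, so empty finite sets suffice. *)
have [[x _]|/set0P/negP/negPn/eqP X0] :=
  pselect ([set: prod_topology X] !=set0); last first.
  exists (fun=> set0); split=> [n|C _ CX]; first by split.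
  exists 0%N => U /CX [_ [x _]].
  by have := I : [set: prod_topology X] x; rewrite X0.
(* The injection [pickle] of pairs into [nat] splits [Y]: its [n]-th subsequence is
   [Y (pickle (n, j))] for varying [j]. *)
have /choice[G GP] : forall n, exists G : nat -> set (prod_topology X),
    (forall j, finite_set (G j) /\ G j `<=` Y (pickle (n, j))) /\
    forall C : set (set (prod_topology (fun k : 'I_n.+1 => X k))),
      finite_set C -> (forall V, C V -> open V /\ V !=set0) ->
      exists j, forall V, C V -> V `&` initial_factors n @` G j !=set0.
  move=> n; have [j|F [FY sepF]] :=
    sepX n (fun j => initial_factors n @` Y (pickle (n, j))).
    exact: dense_initial_factors.
  have /choice[G GP] j := finite_lift _ _ _ _ _ (FY j).1 (FY j).2.
  exists G; split=> [j|C fC oC]; first by have [] := GP j.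
  have [j CF] := sepF C fC oC.
  by exists j => V /CF; have [_ _ ->] := GP j.
(* An index that codes no pair receives the empty set. *)
exists (fun i => if pickle_inv i is Some nj then G nj.1 nj.2 else set0); split.
  move=> i; have := @pickle_invK (nat * nat)%type i.
  case: pickle_inv => [[n j] /= <-|_]; last by split.
  exact: (GP n).1.
move=> C fC oC.
(* Finiteness of [C] gives one [n] that serves all its members. *)
have [n _ Cn] : \forall n \near \oo, forall U, C U ->
    exists2 V, open V /\ V !=set0 & initial_factors n @^-1` V `<=` U.
  apply: near_finite_set => // U /oC[oU [y Uy]].
  have := nbhs_cylinder X y U (open_nbhs_nbhs (conj oU Uy)).
  apply: filterS => n [V]; rewrite nbhsE => -[W [oW Wy] WV VU].
  exists W; first by split => //; exists (initial_factors n y).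
  by move=> z /WV /VU.
have {Cn} /choice[V VP] U :
    exists V : set (prod_topology (fun k : 'I_n.+1 => X k)),
    C U -> (open V /\ V !=set0) /\ initial_factors n @^-1` V `<=` U.
  have [CU|nCU] := pselect (C U); last by exists set0.
  by have [V ? ?] := Cn n (leqnn n) U CU; exists V.
(* A point of [G n j] whose projection lies in [V U] belongs to [U], so it is enough to meet the
   finitely many sets [V U]. *)
have [||j CG] := (GP n).2 (V @` C); first exact: finite_image.
  by move=> _ [U CU <-]; exact: (VP U CU).1.
exists (pickle (n, j)) => U CU; rewrite pickleK_inv /=.
have [|w [Vw [z Gz zw]]] := CG (V U); first by exists U.
by exists z; split => //; apply: (VP U CU).2; rewrite /preimage/= zw.
Qed.
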